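(* For any invoking cost $q>0$, every deterministic on-line exploration strategy $\mathcal{S}$ for edge-weighted rings has competitive ratio at least $\frac{3}{2}$, i.e., $\sup_{C}\mathcal{S}(C)/\mathcal{S}^{opt}(C)\ge \frac32$, where the supremum is over all edge-weighted rings $C$ with the homebase at a vertex $v_0$.
   Context: Exploration model: a connected undirected graph with positive edge weights $w$ and a designated homebase vertex is given, together with an invoking cost $q\ge 0$. A strategy is a sequence of moves, each either (1) invoking a new agent, which appears at the homebase, or (2) an agent traversing an edge incident to its current vertex. A vertex is explored when first visited; a strategy explores the graph when every vertex has been visited by some agent (agents need not return). If $k$ agents are used and agent $i$ traverses total distance $d_i$ (sum of weights of traversed edges, with multiplicity), the cost is $kq+\sum_i d_i$. A ring is a cycle graph with at least $3$ vertices. In the on-line setting the graph is not known in advance: an agent at vertex $v$ knows the weights of the edges incident to $v$ and whether each neighbour of $v$ has been explored, and agents communicate freely; each move depends only on information revealed so far. $\mathcal{S}(C)$ is the cost of $\mathcal{S}$ on $C$ and $\mathcal{S}^{opt}(C)$ is the minimum cost of an off-line strategy (full knowledge of $C$) exploring $C$. The competitive ratio of $\mathcal{S}$ is $\sup_C \mathcal{S}(C)/\mathcal{S}^{opt}(C)$. *)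

(* Defs.v *)
From Stdlib Require Import Reals List Arith Lia.
Import ListNotations.
Open Scope R_scope.

(** * Edge-weighted rings with homebase v0 = vertex 0.
    Vertices are 0, ..., n-1 (n >= 3); edge i joins vertex i and
    vertex (i+1) mod n and has weight [rw i] > 0. *)
Record ring := mkRing {
  rn : nat;
  rn_ge3 : (3 <= rn)%nat;
  rw : nat -> R;
  rw_pos : forall i, (i < rn)%nat -> 0 < rw i }.

Definition fwd_nbr (C : ring) (v : nat) : nat := ((v + 1) mod rn C)%nat.
Definition bwd_nbr (C : ring) (v : nat) : nat := ((v + rn C - 1) mod rn C)%nat.
(** the forward edge of v is edge v (weight rw C v);
    the backward edge of v is edge (bwd_nbr C v). *)

(** * Moves: invoke a new agent (appears at the homebase 0), or let agent
    number [a] (agents numbered 0,1,.. in order of invocation) traverse its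
    forward ([true]) or backward ([false]) incident edge.  A traversal
    order for a non-existent agent is a no-op of cost 0. *)
Inductive move := Invoke | Step (a : nat) (fwd : bool).

Record state := mkState {
  pos : list nat;
  expl : nat -> bool;
  acc : R }.

Definition init_state : state := mkState [] (fun _ => false) 0.

Definition mark (e : nat -> bool) (v : nat) : nat -> bool :=
  fun u => if Nat.eqb u v then true else e u.

Definition set_pos (l : list nat) (a v : nat) : list nat :=
  firstn a l ++ v :: skipn (S a) l.

Definition step (q : R) (C : ring) (s : state) (m : move) : state :=
  match m with
  | Invoke => mkState (pos s ++ [0%nat]) (mark (expl s) 0%nat) (acc s + q)
  | Step a d =>
      if Nat.ltb a (length (pos s)) then
        let v := nth a (pos s) 0%nat in
        let v' := if d then fwd_nbr C v else bwd_nbr C v in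
        let wt := if d then rw C v else rw C (bwd_nbr C v) in
        mkState (set_pos (pos s) a v') (mark (expl s) v') (acc s + wt)
      else s
  end.

Definition explored (C : ring) (s : state) : Prop :=
  forall v, (v < rn C)%nat -> expl s v = true.

(** * Off-line strategies: arbitrary finite move sequences (full knowledge). *)
Definition exec (q : R) (C : ring) (ms : list move) : state :=
  fold_left (step q C) ms init_state.

(** * On-line information.
    The local view of an agent at vertex v: weights of its backward and
    forward incident edges, and whether its backward / forward neighbour
    is explored.  Agents communicate freely, so after every move the
    strategy learns the views of all agents (a snapshot). *)
Definition view := (R * R * bool * bool)%type.

Definition view_of (C : ring) (s : state) (v : nat) : view :=
  (rw C (bwd_nbr C v), rw C v, expl s (bwd_nbr C v), expl s (fwd_nbr C v)).

Definition snapshot (C : ring) (s : state) : list view :=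
  map (view_of C s) (pos s).

(** A deterministic on-line strategy chooses the next move as a function of
    the history of snapshots revealed so far (it never sees the ring itself). *)
Definition strategy := list (list view) -> move.

Fixpoint run (q : R) (C : ring) (strat : strategy) (t : nat)
  : state * list (list view) :=
  match t with
  | O => (init_state, [snapshot C init_state])
  | S t' =>
      let (s, h) := run q C strat t' in
      let s' := step q C s (strat h) in
      (s', h ++ [snapshot C s'])
  end.

(* Main.v *)
Require Import Defs.
From Stdlib Require Import Reals List.
From Stdlib Require Import ZArith Lia Lra Classical.
Import ListNotations.
Open Scope R_scope.

(** Show the strategy only edges of a tiny weight eps = q/N, until it either
    invokes a second agent or brings its single agent to distance q from the
    homebase; if it does neither, it never explores a ring of length over 2q.
    At that time the explored interval is [-a, b] with a, b <= q, and a walk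
    covering it has length at least a + b + min(a, b).  In the first case the
    ring closes at once: a single agent going around pays q + a + b, while the
    strategy has already paid at least 2q + a + b + min(a, b).  In the second
    case, say b = q, the next edge is very heavy and one vertex is left beyond
    -a.  The optimum visits -a first and pays 2q + 2a; the strategy has paid
    2q + 2a and still has to pay q + a, by sending its agent back or by invoking
    a new one.  All this holds up to O(eps). *)

(** * The integers as universal cover of the ring *)

Definition vtx (n : nat) (z : Z) : nat := Z.to_nat (z mod Z.of_nat n).

Lemma vtx_lt (n : nat) (z : Z) : (0 < n)%nat -> (vtx n z < n)%nat.
Proof.
  intros Hn. unfold vtx.
  pose proof (Z.mod_pos_bound z (Z.of_nat n) ltac:(lia)). lia.
Qed.

Lemma vtx_unique (n : nat) (k z : Z) (v : nat) :
  (v < n)%nat -> z = (k * Z.of_nat n + Z.of_nat v)%Z -> vtx n z = v.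
Proof.
  intros Hv ->. unfold vtx.
  rewrite Z.add_comm, Z.mod_add, Z.mod_small by lia. lia.
Qed.

Lemma vtx_decomp (n : nat) (z : Z) :
  (0 < n)%nat -> z = ((z / Z.of_nat n) * Z.of_nat n + Z.of_nat (vtx n z))%Z.
Proof.
  intros Hn. unfold vtx.
  pose proof (Z.mod_pos_bound z (Z.of_nat n) ltac:(lia)).
  pose proof (Z.div_mod z (Z.of_nat n) ltac:(lia)). lia.
Qed.

Lemma vtx_inj (n : nat) (y z : Z) :
  (0 < n)%nat -> vtx n y = vtx n z -> (Z.abs (y - z) < Z.of_nat n)%Z -> y = z.
Proof.
  intros Hn E Hyz.
  pose proof (vtx_decomp n y Hn) as Hy. pose proof (vtx_decomp n z Hn) as Hz.
  rewrite E in Hy.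
  assert (y / Z.of_nat n = z / Z.of_nat n)%Z by nia. congruence.
Qed.

Lemma vtx_onto (n v : nat) (l h : Z) :
  (v < n)%nat -> (Z.of_nat n <= h - l + 1)%Z ->
  exists z, (l <= z <= h)%Z /\ v = vtx n z.
Proof.
  intros Hv Hlh.
  pose proof (Z.mod_pos_bound (Z.of_nat v - l) (Z.of_nat n) ltac:(lia)) as B.
  pose proof (Z.div_mod (Z.of_nat v - l) (Z.of_nat n) ltac:(lia)) as D.
  exists (l + (Z.of_nat v - l) mod Z.of_nat n)%Z. split; [lia|].
  symmetry.
  apply (vtx_unique n (- ((Z.of_nat v - l) / Z.of_nat n))%Z); lia.
Qed.

Lemma fwd_nbr_vtx (C : ring) (z : Z) :
  fwd_nbr C (vtx (rn C) z) = vtx (rn C) (z + 1).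
Proof.
  pose proof (rn_ge3 C) as Hn. unfold fwd_nbr. symmetry.
  pose proof (vtx_decomp (rn C) z ltac:(lia)) as Hz.
  pose proof (vtx_lt (rn C) z ltac:(lia)) as Hlt.
  set (v := vtx (rn C) z) in *.
  destruct (Nat.eq_dec (v + 1) (rn C)) as [E|E].
  - rewrite E, Nat.Div0.mod_same.
    apply (vtx_unique _ (z / Z.of_nat (rn C) + 1)%Z); lia.
  - rewrite Nat.mod_small by lia.
    apply (vtx_unique _ (z / Z.of_nat (rn C))%Z); lia.
Qed.

Lemma bwd_nbr_vtx (C : ring) (z : Z) :
  bwd_nbr C (vtx (rn C) z) = vtx (rn C) (z - 1).
Proof.
  pose proof (rn_ge3 C) as Hn. unfold bwd_nbr. symmetry.
  pose proof (vtx_decomp (rn C) z ltac:(lia)) as Hz.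
  pose proof (vtx_lt (rn C) z ltac:(lia)) as Hlt.
  set (v := vtx (rn C) z) in *.
  destruct (Nat.eq_dec v 0) as [E|E].
  - rewrite E, Nat.mod_small by lia.
    apply (vtx_unique _ (z / Z.of_nat (rn C) - 1)%Z); lia.
  - replace (v + rn C - 1)%nat with (v - 1 + 1 * rn C)%nat by lia.
    rewrite Nat.Div0.mod_add, Nat.mod_small by lia.
    apply (vtx_unique _ (z / Z.of_nat (rn C))%Z); lia.
Qed.

(** Forms free of [mod], so that [lia] can check a potential edge by edge. *)
Lemma fwd_nbr_cases (C : ring) (v : nat) : (v < rn C)%nat ->
  (fwd_nbr C v = 0 /\ v + 1 = rn C \/ fwd_nbr C v = v + 1 /\ v + 1 < rn C)%nat.
Proof.
  intros Hv. unfold fwd_nbr. destruct (Nat.eq_dec (v + 1) (rn C)) as [E|E].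
  - left. rewrite E, Nat.Div0.mod_same. lia.
  - right. rewrite Nat.mod_small; lia.
Qed.

Lemma bwd_nbr_cases (C : ring) (v : nat) : (v < rn C)%nat ->
  (v = 0 /\ bwd_nbr C v = rn C - 1 \/ 0 < v /\ bwd_nbr C v = v - 1)%nat.
Proof.
  intros Hv. unfold bwd_nbr. destruct (Nat.eq_dec v 0) as [E|E].
  - left. rewrite E, Nat.mod_small; lia.
  - right. replace (v + rn C - 1)%nat with (v - 1 + 1 * rn C)%nat by lia.
    rewrite Nat.Div0.mod_add, Nat.mod_small; lia.
Qed.

(** * Valid positions and monotone cost along a run *)

Definition on_ring (C : ring) (s : state) : Prop :=
  Forall (fun v => (v < rn C)%nat) (Defs.pos s).

Lemma Forall_set_pos (P : nat -> Prop) (l : list nat) (a v : nat) :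
  Forall P l -> P v -> Forall P (set_pos l a v).
Proof.
  intros Hl Hv. unfold set_pos. apply Forall_app. split.
  - rewrite <- (firstn_skipn a l) in Hl. now apply Forall_app in Hl.
  - constructor; [exact Hv|].
    rewrite <- (firstn_skipn (S a) l) in Hl. now apply Forall_app in Hl.
Qed.

Lemma step_on_ring (q : R) (C : ring) (s : state) (m : move) :
  0 < q -> on_ring C s ->
  on_ring C (step q C s m) /\ acc s <= acc (step q C s m).
Proof.
  intros Hq Hs. pose proof (rn_ge3 C) as Hn. unfold on_ring in *.
  destruct m as [|a d]; simpl.
  - split; [|lra]. apply Forall_app. split; [exact Hs|].
    repeat constructor. lia.
  - destruct (Nat.ltb_spec a (length (Defs.pos s))) as [Ha|Ha]; simpl; [|split; [exact Hs|lra]].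
    assert (Hv : (nth a (Defs.pos s) 0 < rn C)%nat).
    { rewrite Forall_forall in Hs. apply Hs, nth_In, Ha. }
    assert (Hf : (fwd_nbr C (nth a (Defs.pos s) 0) < rn C)%nat)
      by (apply Nat.mod_upper_bound; lia).
    assert (Hb : (bwd_nbr C (nth a (Defs.pos s) 0) < rn C)%nat)
      by (apply Nat.mod_upper_bound; lia).
    split.
    + apply Forall_set_pos; [exact Hs|]. now destruct d.
    + destruct d; [pose proof (rw_pos C _ Hv)|pose proof (rw_pos C _ Hb)]; lra.
Qed.

Lemma run_S (q : R) (C : ring) (S : strategy) (t : nat) :
  run q C S (Datatypes.S t) =
    (step q C (fst (run q C S t)) (S (snd (run q C S t))),
     snd (run q C S t) ++
       [snapshot C (step q C (fst (run q C S t)) (S (snd (run q C S t))))]).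
Proof. simpl. now destruct (run q C S t). Qed.

Lemma run_on_ring (q : R) (C : ring) (S : strategy) (t : nat) :
  0 < q -> on_ring C (fst (run q C S t)).
Proof.
  intros Hq. induction t as [|t IH].
  - constructor.
  - rewrite run_S. simpl fst. now apply step_on_ring.
Qed.

Lemma run_acc_le (q : R) (C : ring) (S : strategy) (t t' : nat) :
  0 < q -> (t <= t')%nat ->
  acc (fst (run q C S t)) <= acc (fst (run q C S t')).
Proof.
  intros Hq H. induction H as [|t' _ IH]; [lra|].
  rewrite run_S. simpl fst. eapply Rle_trans; [exact IH|].
  apply step_on_ring; [exact Hq|]. now apply run_on_ring.
Qed.

(** * Potentials bounding the cost of reaching a vertex *)

(* [phi] is a lower bound, after a reference instant of cost [base], on the
   extra cost of having some agent at a given vertex. *)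
Definition guarded (C : ring) (u : nat) (phi : nat -> R) (base : R) (s : state) : Prop :=
  on_ring C s /\ base <= acc s /\
  (base + phi u <= acc s \/
   expl s u = false /\ Forall (fun v => v <> u /\ base + phi v <= acc s) (Defs.pos s)).

(** Along an edge [phi] grows by at most the weight, and a new agent costs [q >= phi 0], so each
    move pays for the bound at the vertex it reaches. Entering [u] establishes the first
    alternative, which persists because costs never decrease; hence the inequalities are asked away
    from [u] only. *)
Lemma guarded_step (q : R) (C : ring) (u : nat) (phi : nat -> R) (base : R)
    (s : state) (m : move) :
  0 < q -> u <> 0%nat -> phi 0%nat <= q ->
  (forall v, (v < rn C)%nat -> v <> u ->
     phi (fwd_nbr C v) <= phi v + rw C v /\
     phi (bwd_nbr C v) <= phi v + rw C (bwd_nbr C v)) ->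
  guarded C u phi base s -> guarded C u phi base (step q C s m).
Proof.
  intros Hq Hu0 Hphi0 Hphi (Hs & Hb & Hg).
  destruct (step_on_ring q C s m Hq Hs) as [Hs' Hacc].
  split; [exact Hs'|]. split; [lra|].
  destruct Hg as [Hg|[Hu Hall]]; [left; lra|].
  unfold on_ring in Hs.
  destruct m as [|a d]; simpl in *.
  - right. unfold mark. split.
    + destruct (Nat.eqb_spec u 0); [contradiction|exact Hu].
    + apply Forall_app. split.
      * eapply Forall_impl; [|exact Hall]. simpl. intros v [H1 H2]. split; [exact H1|lra].
      * constructor; [|constructor]. split; [congruence|lra].
  - destruct (Nat.ltb_spec a (length (Defs.pos s))) as [Ha|Ha]; simpl in *; [|right; auto].
    set (v := nth a (Defs.pos s) 0%nat) in *.
    assert (Hin : In v (Defs.pos s)) by (apply nth_In, Ha).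
    rewrite Forall_forall in Hs.
    pose proof (proj1 (Forall_forall _ _) Hall v Hin) as [Hvu Hv].
    destruct (Hphi v (Hs v Hin) Hvu) as [Hf Hbw].
    set (v' := if d then fwd_nbr C v else bwd_nbr C v) in *.
    set (wt := if d then rw C v else rw C (bwd_nbr C v)) in *.
    assert (Hv' : base + phi v' <= acc s + wt) by (destruct d; unfold v', wt; lra).
    destruct (Nat.eq_dec u v') as [E|E].
    + left. rewrite E. exact Hv'.
    + right. unfold mark. split.
      * destruct (Nat.eqb_spec u v'); [contradiction|exact Hu].
      * apply Forall_set_pos; [|split; [auto|exact Hv']].
        eapply Forall_impl; [|exact Hall]. simpl. intros w [H1 H2]. split; [exact H1|lra].
Qed.

Lemma guarded_run (q : R) (C : ring) (S : strategy) (u : nat) (phi : nat -> R)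
    (base : R) (t t' : nat) :
  0 < q -> u <> 0%nat -> phi 0%nat <= q ->
  (forall v, (v < rn C)%nat -> v <> u ->
     phi (fwd_nbr C v) <= phi v + rw C v /\
     phi (bwd_nbr C v) <= phi v + rw C (bwd_nbr C v)) ->
  guarded C u phi base (fst (run q C S t)) -> (t <= t')%nat ->
  guarded C u phi base (fst (run q C S t')).
Proof.
  intros Hq Hu0 Hphi0 Hphi Hg H. induction H as [|t' _ IH]; [exact Hg|].
  rewrite run_S. simpl fst. now apply guarded_step.
Qed.

(** * A single agent on the line *)

(* A single agent on the line Z with homebase 0: its position, the explored
   interval [lo, hi], and the number of steps made. *)
Record walk := mkWalk { wp : Z; wlo : Z; whi : Z; wt : Z }.

Definition start : walk := mkWalk 0 0 0 0.

Definition dir (d : bool) : Z := if d then 1%Z else (-1)%Z.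

Definition go (d : bool) (w : walk) : walk :=
  mkWalk (wp w + dir d) (Z.min (wlo w) (wp w + dir d))
         (Z.max (whi w) (wp w + dir d)) (wt w + 1).

(* Second invocations are outside the model: they leave the walk unchanged. *)
Definition lstep (o : option walk) (m : move) : option walk :=
  match o, m with
  | None, Invoke => Some start
  | Some w, Step O d => Some (go d w)
  | _, _ => o
  end.

(** One comparison per neighbour suffices, since the agent stands inside the explored interval. *)
Definition lsnapshot (eps : R) (o : option walk) : list view :=
  match o with
  | None => []
  | Some w => [(eps, eps, (wlo w <=? wp w - 1)%Z, (wp w + 1 <=? whi w)%Z)]
  end.

(** No ring occurs here: the adversary can inspect this run first and choose the ring afterwards. *)
Fixpoint lrun (eps : R) (S : strategy) (t : nat) : option walk * list (list view) :=
  match t with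
  | O => (None, [lsnapshot eps None])
  | Datatypes.S t' =>
      let (o, h) := lrun eps S t' in
      let o' := lstep o (S h) in
      (o', h ++ [lsnapshot eps o'])
  end.

Lemma lrun_S (eps : R) (S : strategy) (t : nat) :
  lrun eps S (Datatypes.S t) =
    (lstep (fst (lrun eps S t)) (S (snd (lrun eps S t))),
     snd (lrun eps S t) ++
       [lsnapshot eps (lstep (fst (lrun eps S t)) (S (snd (lrun eps S t))))]).
Proof. simpl. now destruct (lrun eps S t). Qed.

(* The last clause: covering [lo, hi] from 0 and ending at p passes one of the
   two ends first. *)
Definition walk_ok (w : walk) : Prop :=
  (wlo w <= wp w <= whi w /\ wlo w <= 0 <= whi w /\
   2 * (whi w - wlo w) - Z.abs (wp w) <= wt w)%Z.

(** When the interval grows by 1, the agent stands at the new end and its distance from 0 grows by 1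
    too, so the lower bound rises by 2 - 1. Otherwise only the distance changes, by 1. *)
Lemma go_ok (d : bool) (w : walk) : walk_ok w -> walk_ok (go d w).
Proof. unfold walk_ok, go, dir. destruct d; cbn [wp wlo whi wt]; lia. Qed.

Lemma lrun_ok (eps : R) (S : strategy) (t : nat) (w : walk) :
  fst (lrun eps S t) = Some w -> walk_ok w.
Proof.
  revert w. induction t as [|t IH]; intros w; [discriminate|].
  rewrite lrun_S. simpl fst. destruct (fst (lrun eps S t)) as [w0|].
  - specialize (IH w0 eq_refl).
    destruct (S _) as [|[|a] d]; intros E; injection E as <-; [exact IH| |exact IH].
    now apply go_ok.
  - destruct (S _) as [|a d]; [|discriminate]. intros E. injection E as <-.
    unfold walk_ok, start. simpl. lia.
Qed.

Lemma lrun_grow (eps : R) (S : strategy) (t t' : nat) (w : walk) :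
  (t <= t')%nat -> fst (lrun eps S t) = Some w ->
  exists w', fst (lrun eps S t') = Some w' /\ (wlo w' <= wlo w /\ whi w <= whi w')%Z.
Proof.
  intros H E. induction H as [|t' _ (w' & E' & Hw')].
  - exists w. split; [exact E|lia].
  - rewrite lrun_S. simpl fst. rewrite E'.
    destruct (S _) as [|[|a] d]; simpl; eexists; split; try reflexivity; simpl; lia.
Qed.

(** * Agreement between a run on the ring and the walk on the line *)

(** Exploration is stated through some integer representative, so that it stays correct when the
    interval wraps around the whole ring, as it does in off-line sweeps. *)
Definition tracks (q eps : R) (C : ring) (s : state) (o : option walk) : Prop :=
  match o with
  | None => s = init_state
  | Some w =>
      walk_ok w /\ Defs.pos s = [vtx (rn C) (wp w)] /\
      (forall v, (v < rn C)%nat ->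
         expl s v = true <-> exists z, (wlo w <= z <= whi w)%Z /\ v = vtx (rn C) z) /\
      acc s = q + eps * IZR (wt w)
  end.

(* Edge z of the line joins z and z + 1. *)
Definition flat (eps : R) (C : ring) (l h : Z) : Prop :=
  forall z, (l <= z < h)%Z -> rw C (vtx (rn C) z) = eps.

Lemma tracks_start (q eps : R) (C : ring) :
  tracks q eps C (step q C init_state Invoke) (Some start).
Proof.
  pose proof (rn_ge3 C) as Hn.
  assert (V0 : vtx (rn C) 0 = 0%nat) by (apply (vtx_unique _ 0); lia).
  simpl. split; [unfold walk_ok, start; simpl; lia|]. split; [now rewrite V0|].
  split; [|lra].
  intros v Hv. unfold mark. destruct (Nat.eqb_spec v 0) as [->|Hv0].
  - split; [|reflexivity]. intros _. exists 0%Z. split; [lia|auto].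
  - split; [discriminate|]. intros (z & Hz & ->).
    exfalso. apply Hv0. now replace z with 0%Z by lia.
Qed.

Lemma tracks_go (q eps : R) (C : ring) (s : state) (w : walk) (d : bool) :
  rw C (vtx (rn C) (if d then wp w else wp w - 1)) = eps ->
  tracks q eps C s (Some w) -> tracks q eps C (step q C s (Step 0 d)) (Some (go d w)).
Proof.
  intros Heps (Hok & Hpos & Hex & Hacc).
  simpl step. rewrite Hpos. simpl.
  split; [now apply go_ok|].
  assert (E : (if d then fwd_nbr C (vtx (rn C) (wp w)) else bwd_nbr C (vtx (rn C) (wp w)))
              = vtx (rn C) (wp w + dir d)).
  { unfold dir. destruct d; [apply fwd_nbr_vtx|apply bwd_nbr_vtx]. }
  rewrite E. split; [reflexivity|]. split.
  - intros v Hv. unfold mark. destruct (Nat.eqb_spec v (vtx (rn C) (wp w + dir d))) as [->|Hne].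
    + split; [|reflexivity]. intros _. exists (wp w + dir d)%Z. split; [lia|reflexivity].
    + rewrite (Hex v Hv). unfold walk_ok in Hok. split; intros (z & Hz & ->).
      * exists z. split; [lia|reflexivity].
      * assert (z <> wp w + dir d)%Z by (intros ->; now apply Hne).
        exists z. split; [|reflexivity]. unfold dir in *. destruct d; lia.
  - rewrite Hacc, plus_IZR. rewrite bwd_nbr_vtx.
    destruct d; rewrite Heps; lra.
Qed.

(** Any such [z] is at distance less than [rn C] from every point of the interval, so [vtx] cannot
    identify it with a different explored integer. *)
Lemma tracks_expl (q eps : R) (C : ring) (s : state) (w : walk) (z : Z) :
  tracks q eps C s (Some w) ->
  (whi w - wlo w + 2 <= Z.of_nat (rn C))%Z -> (wlo w - 1 <= z <= whi w + 1)%Z ->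
  expl s (vtx (rn C) z) = andb (wlo w <=? z)%Z (z <=? whi w)%Z.
Proof.
  intros (Hok & Hpos & Hex & Hacc) Hn Hz. pose proof (rn_ge3 C) as Hn3.
  specialize (Hex (vtx (rn C) z) (vtx_lt (rn C) z ltac:(lia))).
  destruct (Z.leb_spec (wlo w) z), (Z.leb_spec z (whi w)); simpl;
    try (apply Hex; exists z; split; [lia|reflexivity]);
    (destruct (expl s _); [|reflexivity]);
    destruct (proj1 Hex eq_refl) as (y & Hy & E); apply vtx_inj in E; lia.
Qed.

Lemma tracks_snapshot (q eps : R) (C : ring) (s : state) (w : walk) :
  tracks q eps C s (Some w) ->
  (whi w - wlo w + 2 <= Z.of_nat (rn C))%Z -> flat eps C (wp w - 1) (wp w + 1) ->
  snapshot C s = lsnapshot eps (Some w).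
Proof.
  intros Ht Hn Hf. pose proof Ht as (Hok & Hpos & _).
  unfold walk_ok in Hok.
  unfold snapshot. rewrite Hpos. simpl. unfold view_of.
  rewrite bwd_nbr_vtx, fwd_nbr_vtx.
  rewrite (Hf (wp w - 1)%Z), (Hf (wp w)) by lia.
  rewrite !(tracks_expl q eps C s w) by (auto; lia).
  replace (wp w - 1 <=? whi w)%Z with true by lia.
  replace (wlo w <=? wp w + 1)%Z with true by lia.
  now rewrite Bool.andb_true_r.
Qed.

Lemma tracks_not_explored (q eps : R) (C : ring) (s : state) (o : option walk) :
  tracks q eps C s o ->
  (forall w, o = Some w -> (whi w - wlo w + 2 <= Z.of_nat (rn C))%Z) ->
  ~ explored C s.
Proof.
  intros Ht Hn He. pose proof (rn_ge3 C) as Hn3. destruct o as [w|].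
  - pose proof (tracks_expl q eps C s w (whi w + 1) Ht (Hn w eq_refl)) as H.
    destruct Ht as (Hok & _). unfold walk_ok in Hok.
    rewrite He in H by (apply vtx_lt; lia). specialize (H ltac:(lia)).
    replace (whi w + 1 <=? whi w)%Z with false in H by lia.
    now rewrite Bool.andb_false_r in H.
  - rewrite Ht in He. specialize (He 0%nat ltac:(lia)). discriminate.
Qed.

Lemma tracks_explored (q eps : R) (C : ring) (s : state) (w : walk) :
  tracks q eps C s (Some w) -> (Z.of_nat (rn C) <= whi w - wlo w + 1)%Z -> explored C s.
Proof.
  intros (_ & _ & Hex & _) Hn v Hv. apply Hex; [exact Hv|]. now apply vtx_onto.
Qed.

(** Indistinguishability: equal histories force equal moves. The bounds are strict because an agent
    at an end of the interval also sees the edge leading out of it. *)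
Lemma run_tracks (q eps : R) (C : ring) (S : strategy) (l h : Z) (t : nat) :
  flat eps C l h ->
  (forall j w, (j <= t)%nat -> fst (lrun eps S j) = Some w ->
     (whi w - wlo w + 2 <= Z.of_nat (rn C) /\ l < wlo w /\ whi w < h)%Z) ->
  (forall j w, (j < t)%nat -> fst (lrun eps S j) = Some w ->
     S (snd (lrun eps S j)) <> Invoke) ->
  tracks q eps C (fst (run q C S t)) (fst (lrun eps S t)) /\
  snd (run q C S t) = snd (lrun eps S t).
Proof.
  intros Hf. induction t as [|t IH]; intros Hb Hi; [split; reflexivity|].
  destruct IH as [IHt IHh]; [intros j w Hj; apply Hb; lia|intros j w Hj; apply Hi; lia|].
  (* The bound at [t] makes the traversed edge flat; the one at [S t] does so for the edges seen on
     arrival. *)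
  specialize (Hb (Datatypes.S t)) as Hb1. specialize (Hb t).
  specialize (Hi t).
  rewrite run_S. rewrite lrun_S in *. simpl fst in *. simpl snd. rewrite IHh.
  assert (Ht : tracks q eps C (step q C (fst (run q C S t)) (S (snd (lrun eps S t))))
                 (lstep (fst (lrun eps S t)) (S (snd (lrun eps S t))))).
  { destruct (fst (lrun eps S t)) as [w|].
    - specialize (Hb w ltac:(lia) eq_refl). specialize (Hi w ltac:(lia) eq_refl).
      pose proof IHt as (Hok & Hpos & _). unfold walk_ok in Hok.
      destruct (S _) as [|[|a] d]; [contradiction| |].
      + apply tracks_go; [|exact IHt]. apply Hf. destruct d; lia.
      + simpl step. rewrite Hpos. exact IHt.
    - rewrite IHt. destruct (S _) as [|a d]; [apply tracks_start|].
      simpl. now destruct a. }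
  split; [exact Ht|]. f_equal. f_equal.
  destruct (lstep _ _) as [w'|]; [|rewrite Ht; reflexivity].
  specialize (Hb1 w' ltac:(lia) eq_refl). pose proof Ht as (Hok & _). unfold walk_ok in Hok.
  apply tracks_snapshot with (q := q); [exact Ht|lia|].
  intros z Hz. apply Hf. lia.
Qed.

(** * Off-line sweeps by one agent *)

Lemma tracks_straight (q eps : R) (C : ring) (d : bool) (k : nat) (s : state) (w : walk) :
  tracks q eps C s (Some w) ->
  flat eps C (if d then wp w else wp w - Z.of_nat k) (if d then wp w + Z.of_nat k else wp w) ->
  exists w', tracks q eps C (fold_left (step q C) (repeat (Step 0 d) k) s) (Some w') /\
    (wp w' = wp w + dir d * Z.of_nat k /\ wlo w' <= wlo w /\ whi w <= whi w' /\
     wt w' = wt w + Z.of_nat k)%Z.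
Proof.
  revert s w. induction k as [|k IH]; intros s w Ht Hf.
  - exists w. split; [exact Ht|]. lia.
  - simpl. destruct (IH (step q C s (Step 0 d)) (go d w)) as (w' & Ht' & Hw').
    + apply tracks_go; [|exact Ht]. apply Hf. destruct d; lia.
    + intros z Hz. apply Hf. unfold go, dir in Hz. destruct d; cbn [wp wlo whi wt] in *; lia.
    + exists w'. split; [exact Ht'|]. unfold go, dir in *. destruct d; cbn [wp wlo whi wt] in *; lia.
Qed.

(** The [k] edges on side [d] are walked twice, the [m] on the other side once; [k = 0] is a single
    trip around. *)
Lemma offline_sweep (q eps : R) (C : ring) (d : bool) (k m : nat) :
  flat eps C (if d then - Z.of_nat m else - Z.of_nat k)
             (if d then Z.of_nat k else Z.of_nat m) ->
  (rn C <= k + m + 1)%nat ->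
  let ms := Invoke :: repeat (Step 0 d) k ++ repeat (Step 0 (negb d)) (k + m) in
  explored C (exec q C ms) /\ acc (exec q C ms) = q + eps * IZR (Z.of_nat (2 * k + m)).
Proof.
  intros Hf Hn ms. unfold exec, ms. cbn [fold_left]. rewrite fold_left_app.
  destruct (tracks_straight q eps C d k _ _ (tracks_start q eps C)) as (w1 & Ht1 & H1).
  { intros z Hz. apply Hf. unfold start in Hz. destruct d; cbn [wp wlo whi wt] in *; lia. }
  destruct (tracks_straight q eps C (negb d) (k + m) _ _ Ht1) as (w2 & Ht2 & H2).
  { intros z Hz. apply Hf. unfold start, dir in *. destruct d; cbn [wp wlo whi wt negb] in *; lia. }
  pose proof Ht1 as (Hok1 & _). pose proof Ht2 as (Hok2 & _ & _ & Hacc).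
  unfold walk_ok, start, dir in *.
  split.
  - apply (tracks_explored q eps C _ w2 Ht2). destruct d; cbn [wp wlo whi wt negb] in *; lia.
  - rewrite Hacc. do 3 f_equal. cbn [wp wlo whi wt negb] in *; lia.
Qed.

(** * The adversary's rings and the ratio estimate *)

Lemma spike_pos (n s : nat) (eps : R) :
  0 < eps -> forall i, (i < n)%nat ->
  0 < eps * IZR (if Nat.eqb i s then Z.of_nat n else 1).
Proof.
  intros He i Hi. apply Rmult_lt_0_compat; [exact He|].
  apply (IZR_lt 0). destruct (Nat.eqb i s); lia.
Qed.

(* All edges have weight [eps] except edge [s], too heavy to be worth crossing;
   for [n <= s] there is no such edge. *)
Definition spike_ring (n s : nat) (eps : R) (Hn : (3 <= n)%nat) (He : 0 < eps) : ring :=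
  mkRing n Hn (fun i => eps * IZR (if Nat.eqb i s then Z.of_nat n else 1))
         (spike_pos n s eps He).

Lemma spike_flat (n s : nat) (eps : R) (Hn : (3 <= n)%nat) (He : 0 < eps) (l h : Z) :
  (forall z, (l <= z < h)%Z -> vtx n z <> s) -> flat eps (spike_ring n s eps Hn He) l h.
Proof.
  intros H z Hz. cbn [rn rw spike_ring]. destruct (Nat.eqb_spec (vtx n z) s) as [E|_].
  - now apply H in E.
  - lra.
Qed.

(** Lowering the factor from 3/2 to [r] gains at least [(3/2 - r) * q >= 3 * eps], which absorbs the
    discretization error. *)
Lemma ratio_slack (q eps r x y : R) :
  3 * eps <= (3/2 - r) * q -> 0 < q -> r < 3/2 -> 0 <= y ->
  3 * (q + eps * y) < 2 * (q + eps * x) + 6 * eps -> 0 < eps ->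
  r * (q + eps * y) < q + eps * x.
Proof.
  intros H1 Hq Hr Hy H2 He.
  assert (0 <= (3/2 - r) * (eps * y))
    by (apply Rmult_le_pos; [lra|apply Rmult_le_pos; lra]).
  lra.
Qed.

(** * The three ways to defeat the strategy *)

(** The cost of [ms] bounds the optimum from above; a strategy that never explores [C] is beaten
    outright. *)
Definition beats (q : R) (S : strategy) (r : R) : Prop :=
  exists (C : ring) (ms : list move),
    explored C (exec q C ms) /\
    forall t : nat, explored C (fst (run q C S t)) ->
      r * acc (exec q C ms) < acc (fst (run q C S t)).

(** Neither trigger of the adversary has occurred; with [q = eps * N], being [N] steps away means
    distance [q]. *)
Definition calm (eps : R) (S : strategy) (N : nat) (i : nat) : Prop :=
  (forall j w, (j <= i)%nat -> fst (lrun eps S j) = Some w ->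
     (- Z.of_nat N < wlo w /\ whi w < Z.of_nat N)%Z) /\
  (forall j w, (j < i)%nat -> fst (lrun eps S j) = Some w ->
     S (snd (lrun eps S j)) <> Invoke).

(** The explored interval only grows, so bounds at the last instant [i] serve for all earlier
    ones. *)
Lemma calm_tracks (q eps : R) (C : ring) (S : strategy) (N i j : nat) (l h : Z) :
  calm eps S N i -> (j <= i)%nat -> flat eps C l h ->
  (forall w, fst (lrun eps S i) = Some w ->
     (whi w - wlo w + 2 <= Z.of_nat (rn C) /\ l < wlo w /\ whi w < h)%Z) ->
  (exists w, fst (lrun eps S i) = Some w) ->
  tracks q eps C (fst (run q C S j)) (fst (lrun eps S j)) /\
  snd (run q C S j) = snd (lrun eps S j) /\ ~ explored C (fst (run q C S j)).
Proof.
  intros [_ Hi] Hj Hf Hb [wi Ei]. specialize (Hb wi Ei).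
  assert (B : forall k w, (k <= j)%nat -> fst (lrun eps S k) = Some w ->
     (whi w - wlo w + 2 <= Z.of_nat (rn C) /\ l < wlo w /\ whi w < h)%Z).
  { intros k w Hk E. destruct (lrun_grow eps S k i w ltac:(lia) E) as (w' & E' & G).
    rewrite Ei in E'. injection E' as <-. lia. }
  destruct (run_tracks q eps C S l h j Hf B) as [Ht Hs].
  { intros k w Hk. apply Hi. lia. }
  split; [exact Ht|]. split; [exact Hs|].
  eapply tracks_not_explored; [exact Ht|]. intros w E. now apply (B j w).
Qed.

Lemma beats_second_agent (q eps : R) (S : strategy) (r : R) (N i : nat) (w : walk) :
  0 < eps -> q = eps * IZR (Z.of_nat N) -> 0 < q -> r < 3/2 ->
  3 * eps <= (3/2 - r) * q ->
  calm eps S N i -> fst (lrun eps S i) = Some w -> S (snd (lrun eps S i)) = Invoke ->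
  beats q S r.
Proof.
  intros He Hq Hq0 Hr Hslack Hc Ew Em.
  pose proof (lrun_ok _ _ _ _ Ew) as Hok.
  destruct (proj1 Hc i w (le_n i) Ew) as [Hlo Hhi]. unfold walk_ok in Hok.
  (* Two vertices are left unexplored, which gives [n >= 3] even if the agent has not moved. *)
  set (n := Z.to_nat (whi w - wlo w + 3)).
  assert (Hn : (3 <= n)%nat) by lia.
  set (C := spike_ring n n eps Hn He).
  assert (Hf : forall l h, flat eps C l h).
  { intros l h. apply spike_flat. intros z _.
    pose proof (vtx_lt n z ltac:(lia)). lia. }
  destruct (offline_sweep q eps C true 0 (n - 1) (Hf _ _)) as [Hex Hcost];
    [cbn [rn C spike_ring]; lia|].
  eexists C, _. split; [exact Hex|]. rewrite Hcost. clear Hex Hcost.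
  intros t Ht.
  assert (Tr : forall j, (j <= i)%nat -> _) by
    (intros j Hj; refine (calm_tracks q eps C S N i j (wlo w - 1) (whi w + 1) Hc Hj (Hf _ _) _ _);
     [intros w' E'; rewrite Ew in E'; injection E' as <-; cbn [rn C spike_ring]; lia
     |now exists w]).
  destruct (Nat.le_gt_cases t i) as [Hti|Hti]; [now apply Tr in Hti|].
  destruct (Tr i (le_n i)) as (Hi & Hs & _). rewrite Ew in Hi.
  destruct Hi as (_ & _ & _ & Hacc).
  eapply Rlt_le_trans; [|apply run_acc_le; [exact Hq0|exact Hti]].
  rewrite run_S. simpl fst. rewrite Hs, Em. simpl acc. rewrite Hacc.
  replace (q + eps * IZR (wt w) + q) with (q + eps * IZR (wt w + Z.of_nat N))
    by (rewrite plus_IZR, Hq; ring).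
  apply ratio_slack; auto; [apply (IZR_le 0); lia|].
  rewrite Hq.
  (* In units of [eps], with D the interval length and p the position, [wt w >= 2D - |p|] reduces
     this to [2|p| < N + D], true since [|p| <= D] and [|p| < N]. *)
  assert (H : (3 * (Z.of_nat N + Z.of_nat (2 * 0 + (n - 1))) <
               2 * (Z.of_nat N + (wt w + Z.of_nat N)) + 6)%Z) by lia.
  apply IZR_lt in H. rewrite !plus_IZR, !mult_IZR, !plus_IZR in H.
  rewrite plus_IZR. nra.
Qed.

Lemma beats_far_agent (q eps : R) (S : strategy) (r : R) (N i : nat) (w : walk) (d : bool) :
  0 < eps -> q = eps * IZR (Z.of_nat N) -> 0 < q -> r < 3/2 ->
  3 * eps <= (3/2 - r) * q ->
  calm eps S N i -> fst (lrun eps S i) = Some w -> S (snd (lrun eps S i)) = Step 0 d ->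
  (wp w + dir d = dir d * Z.of_nat N)%Z ->
  beats q S r.
Proof.
  intros He Hq Hq0 Hr Hslack Hc Ew Em Hfar.
  pose proof (lrun_ok _ _ _ _ Ew) as Hok.
  pose proof (go_ok d w Hok) as Hok'.
  destruct (proj1 Hc i w (le_n i) Ew) as [Hlo Hhi].
  assert (HN : (0 < N)%nat) by (destruct N; [simpl in Hq; lra|lia]).
  (* [a] is the extent explored on the side opposite to [d]. After the step, [N + a + 1] vertices
     are explored and one, [u] below, is left; the heavy edge [h] joins it to the agent's vertex. *)
  set (a := Z.to_nat (if d then - wlo w else whi w)).
  set (n := (N + a + 2)%nat).
  set (h := if d then N else (a + 1)%nat).
  set (l := (if d then - Z.of_nat (a + 1) else - Z.of_nat N)%Z).
  assert (Hn : (3 <= n)%nat) by lia.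
  set (C := spike_ring n h eps Hn He).
  assert (Hf : flat eps C l (Z.of_nat h)).
  { apply spike_flat. intros z Hz E.
    assert (Eh : vtx n (Z.of_nat h) = h)
      by (apply (vtx_unique _ 0); unfold h, n; destruct d; lia).
    rewrite <- Eh in E. apply vtx_inj in E; [lia|lia|].
    unfold l, h, n in *. destruct d; lia. }
  assert (Hb : (n = Z.to_nat (whi w - wlo w + 3) /\ l < wlo w /\ whi w < Z.of_nat h /\
                0 <= wlo w + Z.of_nat N /\ wlo w <= 0 <= whi w)%Z).
  { unfold walk_ok, dir in *. unfold n, l, h, a. destruct d; lia. }
  destruct (offline_sweep q eps C (negb d) (a + 1) N) as [Hex Hcost].
  { intros z Hz. apply Hf. unfold l, h. destruct d; cbn [negb] in Hz; lia. }
  { cbn [rn C spike_ring]. lia. }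
  eexists C, _. split; [exact Hex|]. rewrite Hcost. clear Hex Hcost.
  intros t Ht.
  assert (Tr : forall j, (j <= i)%nat -> _) by
    (intros j Hj; refine (calm_tracks q eps C S N i j l (Z.of_nat h) Hc Hj Hf _ _);
     [intros w' E'; rewrite Ew in E'; injection E' as <-; cbn [rn C spike_ring]; lia
     |now exists w]).
  destruct (Nat.le_gt_cases t i) as [Hti|Hti]; [now apply Tr in Hti|].
  destruct (Tr i (le_n i)) as (Hi & Hs & _). rewrite Ew in Hi.
  assert (Hi1 : tracks q eps C (fst (run q C S (Datatypes.S i))) (Some (go d w))).
  { rewrite run_S. simpl fst. rewrite Hs, Em. apply tracks_go; [|exact Hi].
    apply Hf. unfold walk_ok in Hok. destruct d; lia. }
  set (u := if d then (N + 1)%nat else (a + 1)%nat).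
  (* Number of light edges from the agent's vertex to [v] once the heavy edge is removed. The
     homebase is at distance [N], so [phi 0 = q]: sending the agent back and invoking a new one cost
     the same. *)
  set (dist := fun v => if d
     then (if (v <=? N)%nat then Z.of_nat N - Z.of_nat v else Z.of_nat (N + n) - Z.of_nat v)%Z
     else (if (v <=? a + 1)%nat then Z.of_nat (N + v) else Z.of_nat (N + v) - Z.of_nat n)%Z).
  set (phi := fun v => eps * IZR (dist v)).
  set (base := acc (fst (run q C S (Datatypes.S i)))).
  assert (Hstep : forall v v' e, (dist v' <= dist v + (if Nat.eqb e h then Z.of_nat n else 1))%Z ->
            phi v' <= phi v + rw C e).
  { intros v v' e H. apply IZR_le in H. rewrite plus_IZR in H.
    unfold phi. cbn [rw C spike_ring]. rewrite <- Rmult_plus_distr_l.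
    apply Rmult_le_compat_l; [lra|exact H]. }
  assert (Hg : guarded C u phi base (fst (run q C S t))).
  { apply guarded_run with (t := Datatypes.S i); [exact Hq0| | | |  |exact Hti].
    - unfold u; destruct d; lia.
    - unfold phi, dist. destruct d; simpl; rewrite ?Z.sub_0_r, ?Nat.add_0_r; lra.
    - intros v Hv Hvu.
      pose proof (fwd_nbr_cases C v Hv) as Hfw. pose proof (bwd_nbr_cases C v Hv) as Hbw.
      cbn [rn C spike_ring] in Hv, Hfw, Hbw.
      split; apply Hstep.
      + generalize dependent (fwd_nbr C v). intros v' Hfw. unfold dist, u, h in *.
        destruct d; destruct (Nat.eqb_spec v N); destruct (Nat.eqb_spec v (a + 1));
          destruct (Nat.leb_spec v N), (Nat.leb_spec v' N), (Nat.leb_spec v (a + 1)),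
            (Nat.leb_spec v' (a + 1)); lia.
      + generalize dependent (bwd_nbr C v). intros v' Hbw. unfold dist, u, h in *.
        destruct d; destruct (Nat.eqb_spec v' N); destruct (Nat.eqb_spec v' (a + 1));
          destruct (Nat.leb_spec v N), (Nat.leb_spec v' N), (Nat.leb_spec v (a + 1)),
            (Nat.leb_spec v' (a + 1)); lia.
    - split; [now apply run_on_ring|]. split; [unfold base; lra|]. right.
      assert (Eu : vtx n (whi (go d w) + 1) = u).
      { apply (vtx_unique _ 0); unfold u, n; unfold walk_ok, go, dir in *;
          destruct d; cbn [wp wlo whi wt] in *; lia. }
      assert (Hsize : (whi (go d w) - wlo (go d w) + 2 <= Z.of_nat n)%Z).
      { unfold walk_ok, go, dir in *. destruct d; cbn [wp wlo whi wt] in *; lia. }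
      split.
      + rewrite <- Eu. change n with (rn C).
        rewrite (tracks_expl q eps C _ _ _ Hi1 Hsize) by (unfold walk_ok in Hok'; lia).
        replace (whi (go d w) + 1 <=? whi (go d w))%Z with false by lia.
        apply Bool.andb_false_r.
      + destruct Hi1 as (_ & Hpos & _). rewrite Hpos. cbn [rn C spike_ring].
        assert (Ep : vtx n (wp (go d w)) = if d then N else (a + 2)%nat).
        { unfold go. cbn [wp]. rewrite Hfar. unfold dir.
          (* For [d = false] the agent is at [-N], which is [a + 2] modulo [n]. *)
          apply (vtx_unique _ (if d then 0 else -1)%Z); destruct d; unfold n; lia. }
        constructor; [|constructor]. rewrite Ep. split; [unfold u; destruct d; lia|].
        assert (E0 : dist (if d then N else (a + 2)%nat) = 0%Z).
        { unfold dist, n. destruct d.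
          - rewrite Nat.leb_refl. lia.
          - destruct (Nat.leb_spec (a + 2) (a + 1)); lia. }
        unfold phi. rewrite E0. unfold base. lra. }
  destruct Hg as (_ & _ & [Hg|[Hu _]]).
  2: { rewrite Ht in Hu; [discriminate|]. cbn [rn C spike_ring]. unfold u, n. destruct d; lia. }
  assert (Eu : dist u = (Z.of_nat n - 1)%Z).
  { unfold dist, u, n. destruct d.
    - destruct (Nat.leb_spec (N + 1) N); lia.
    - rewrite Nat.leb_refl. lia. }
  eapply Rlt_le_trans; [|exact Hg].
  destruct Hi1 as (_ & _ & _ & Hacc). unfold base, phi. rewrite Hacc, Eu.
  replace (q + eps * IZR (wt (go d w)) + eps * IZR (Z.of_nat n - 1))
    with (q + eps * IZR (wt (go d w) + (Z.of_nat n - 1)))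
    by (rewrite (plus_IZR (wt (go d w))); ring).
  apply ratio_slack; auto; [apply (IZR_le 0); lia|].
  rewrite Hq.
  (* Here [wt (go d w) >= N + 2a], so the sides are [6N + 6a + 6] and at least [6N + 6a + 8]. *)
  assert (H : (3 * (Z.of_nat N + Z.of_nat (2 * (a + 1) + N)) <
               2 * (Z.of_nat N + (wt (go d w) + (Z.of_nat n - 1))) + 6)%Z).
  { unfold walk_ok, go, dir, n, a in *. destruct d; cbn [wp wlo whi wt] in *; lia. }
  apply IZR_lt in H. rewrite plus_IZR, !mult_IZR, !plus_IZR in H.
  rewrite plus_IZR. nra.
Qed.

Lemma beats_calm (q eps : R) (S : strategy) (r : R) (N : nat) :
  0 < eps -> (forall i, calm eps S N i) -> beats q S r.
Proof.
  intros He Hc.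
  (* A calm walk explores at most [2N - 1] vertices, so this ring is never finished. *)
  set (n := (2 * N + 3)%nat).
  assert (Hn : (3 <= n)%nat) by lia.
  set (C := spike_ring n n eps Hn He).
  assert (Hf : forall l h, flat eps C l h).
  { intros l h. apply spike_flat. intros z _.
    pose proof (vtx_lt n z ltac:(lia)). lia. }
  destruct (offline_sweep q eps C true 0 (n - 1) (Hf _ _)) as [Hex _];
    [cbn [rn C spike_ring]; lia|].
  eexists C, _. split; [exact Hex|]. intros t Ht. exfalso. revert Ht.
  destruct (Hc t) as [Hb Hi].
  destruct (run_tracks q eps C S (- Z.of_nat N) (Z.of_nat N) t (Hf _ _)) as [Htr _].
  - intros j w Hj E. specialize (Hb j w Hj E). cbn [rn C spike_ring]. lia.
  - exact Hi.
  - eapply tracks_not_explored; [exact Htr|]. intros w E.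
    specialize (Hb t w (le_n t) E). cbn [rn C spike_ring]. lia.
Qed.

Theorem theorem1 (q : R) (hq : 0 < q) (S : strategy) (r : R) (hr : r < 3/2) :
  exists (C : ring) (ms : list move),
    explored C (exec q C ms) /\
    forall t : nat, explored C (fst (run q C S t)) ->
      r * acc (exec q C ms) < acc (fst (run q C S t)).
Proof.
  change (beats q S r).
  (* This size of [N] gives [eps = q / N] the slack that [ratio_slack] requires. *)
  destruct (INR_unbounded (3 / (3/2 - r))) as [N HN].
  assert (HN0 : 0 < 3 / (3/2 - r)) by (apply Rdiv_lt_0_compat; lra).
  rewrite INR_IZR_INZ in HN.
  set (eps := q / IZR (Z.of_nat N)).
  assert (He : 0 < eps) by (apply Rdiv_lt_0_compat; lra).
  assert (Hq : q = eps * IZR (Z.of_nat N)) by (unfold eps; field; lra).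
  assert (Hslack : 3 * eps <= (3/2 - r) * q).
  { apply Rmult_lt_compat_r with (r := 3/2 - r) in HN; [|lra].
    unfold Rdiv in HN at 1. rewrite Rmult_assoc, Rinv_l, Rmult_1_r in HN by lra.
    rewrite Hq at 1. nra. }
  assert (HNpos : (0 < N)%nat) by (destruct N; [simpl in HN; lra|lia]).
  (* Under [Hno] either trigger, at its first occurrence, is contradictory, so by induction every
     instant is calm. *)
  destruct (classic (beats q S r)) as [H|Hno]; [exact H|].
  apply (beats_calm q eps S r N He). intros i. induction i as [|i IH].
  { split; [|intros j w Hj; lia].
    intros j w Hj E. replace j with 0%nat in E by lia. discriminate. }
  pose proof IH as [Hb Hi]. split.
  - intros j w Hj E. destruct (Nat.eq_dec j (Datatypes.S i)) as [->|Hne]; [|apply (Hb j); auto; lia].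
    rewrite lrun_S in E. simpl fst in E. destruct (fst (lrun eps S i)) as [w0|] eqn:E0.
    + specialize (Hb i w0 (le_n i) E0). pose proof (lrun_ok _ _ _ _ E0) as Hok.
      destruct (S (snd (lrun eps S i))) as [|[|a] d] eqn:Em; simpl in E; injection E as <-;
        [exact Hb| |exact Hb].
      destruct (Z.eq_dec (wp w0 + dir d) (dir d * Z.of_nat N)) as [Hfar|Hfar].
      * exfalso. apply Hno. now apply (beats_far_agent q eps S r N i w0 d).
      * unfold walk_ok, go, dir in *. destruct d; cbn [wp wlo whi wt] in *; lia.
    + destruct (S (snd (lrun eps S i))) as [|a d]; simpl in E; [|discriminate].
      injection E as <-. simpl. lia.
  - intros j w Hj E. destruct (Nat.eq_dec j i) as [->|Hne]; [|apply (Hi j w); auto; lia].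
    intros Em. apply Hno. now apply (beats_second_agent q eps S r N i w).
Qed.
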